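(* Let $\mathcal{X}$ be a non-empty set, let $D$ be a set of decisions with gain gambles $J_d$ ($d\in D$), let $\underline{P}$ be a lower prevision on a set $\mathcal{K}$ of gambles on $\mathcal{X}$ that avoids sure loss, let $\mathcal{F}$ be a field of subsets of $\mathcal{X}$ such that all $J_d$ ($d\in D$) and all gambles in $\mathcal{K}$ are $\mathcal{F}$-measurable, and let $\mathcal{M}$ be the credal set of $\underline{P}$, and $\underline{\mathbf{E}}_{\underline{P}}$, $\overline{\mathbf{E}}_{\underline{P}}$ the lower and upper natural extensions of $\underline{P}$. Then $$\mathrm{opt}_{\overline{\mathbf{E}}_{\underline{P}}}(D)\subseteq \mathrm{opt}_{\mathcal{M}}(D)\subseteq \mathrm{opt}_{>_{\underline{P}}}(D)\subseteq \mathrm{opt}_{\sqsupset_{\underline{P}}}(D)$$ and $$\mathrm{opt}_{\underline{\mathbf{E}}_{\underline{P}}}(D)\subseteq \mathrm{opt}_{>_{\underline{P}}}(D).$$ That is: every $\Gamma$-maximax decision is E-admissible (in the sense of belonging to $\mathrm{opt}_{\mathcal{M}}(D)$), every decision in $\mathrm{opt}_{\mathcal{M}}(D)$ is maximal, every maximal decision is optimal with respect to interval dominance, and every $\Gamma$-maximin decision is maximal.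
   Context: A gamble on $\mathcal{X}$ is a bounded function $\mathcal{X}\to\mathbb{R}$; $\mathcal{L}(\mathcal{X})$ is the set of all gambles. $D$ is a set and each $d\in D$ has an associated gain gamble $J_d\in\mathcal{L}(\mathcal{X})$. Inequalities between gambles are point-wise. A gamble is $\mathcal{F}$-measurable if it is a uniform limit of $\mathcal{F}$-simple gambles (finite linear combinations of indicators of sets in $\mathcal{F}$). A lower prevision is a real-valued map $\underline{P}$ on a (possibly empty) set $\mathcal{K}\subseteq\mathcal{L}(\mathcal{X})$. It avoids sure loss if there is no finite collection (repetitions allowed) $f_1,\dots,f_n\in\mathcal{K}$ with $\sum_{i=1}^n\underline{P}(f_i)>\sup_{x\in\mathcal{X}}\sum_{i=1}^n f_i(x)$. For a finitely additive probability measure $\mu$ on $\mathcal{F}$, $\mathbf{E}_\mu(f)=\int f\,\mathrm{d}\mu$ is the (Dunford) integral of an $\mathcal{F}$-measurable gamble $f$, i.e. the unique linear, supremum-norm continuous extension of the obvious integral on $\mathcal{F}$-simple gambles. The credal set $\mathcal{M}$ of $\underline{P}$ is the set of all finitely additive probability measures $\mu$ on $\mathcal{F}$ such that $\underline{P}(f)\le\mathbf{E}_\mu(f)$ for all $f\in\mathcal{K}$ (it is non-empty because $\underline{P}$ avoids sure loss). For an $\mathcal{F}$-measurable gamble $g$, $\underline{\mathbf{E}}_{\underline{P}}(g)=\min_{\mu\in\mathcal{M}}\mathbf{E}_\mu(g)$; equivalently $$\underline{\mathbf{E}}_{\underline{P}}(g)=\sup\Big\{\alpha+\sum_{i=1}^n\lambda_i\underline{P}(f_i)\colon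 \alpha+\sum_{i=1}^n\lambda_i f_i\le g\Big\},$$ over $\alpha\in\mathbb{R}$, $n\ge 0$, $\lambda_i\ge 0$, $f_i\in\mathcal{K}$. The upper natural extension is $\overline{\mathbf{E}}_{\underline{P}}(g)=-\underline{\mathbf{E}}_{\underline{P}}(-g)$. Admissible decisions: $\mathrm{opt}_{\ge}(D)=\{d\in D\colon(\forall e\in D)(J_e\not\ge J_d\text{ or }J_e=J_d)\}$. Optimality operators (an $\arg\max$ is empty if no maximum is attained): - $\mathrm{opt}_{\mathbf{E}_\mu}(D)=\arg\max_{d\in\mathrm{opt}_{\ge}(D)}\mathbf{E}_\mu(J_d)$ (maximal expected utility); - $\mathrm{opt}_{\underline{\mathbf{E}}_{\underline{P}}}(D)=\arg\max_{d\in\mathrm{opt}_{\ge}(D)}\underline{\mathbf{E}}_{\underline{P}}(J_d)$ ($\Gamma$-maximin); - $\mathrm{opt}_{\overline{\mathbf{E}}_{\underline{P}}}(D)=\arg\max_{d\in\mathrm{opt}_{\ge}(D)}\overline{\mathbf{E}}_{\underline{P}}(J_d)$ ($\Gamma$-maximax); - $\mathrm{opt}_{>_{\underline{P}}}(D)=\{d\in\mathrm{opt}_{\ge}(D)\colon(\forall e\in\mathrm{opt}_{\ge}(D))(\underline{\mathbf{E}}_{\underline{P}}(J_e-J_d)\le 0)\}$ (maximality); - $\mathrm{opt}_{\sqsupset_{\underline{P}}}(D)=\{d\in\mathrm{opt}_{\ge}(D)\colon(\forall e\in\mathrm{opt}_{\ge}(D))(\underline{\mathbf{E}}_{\underline{P}}(J_e)\le\overline{\mathbf{E}}_{\underline{P}}(J_d))\}$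 (interval dominance); - $\mathrm{opt}_{\mathcal{M}}(D)=\bigcup_{\mu\in\mathcal{M}}\mathrm{opt}_{\mathbf{E}_\mu}(D)$ (E-admissibility). *)

(* Defs.v *)
From HB Require Import structures.
From mathcomp Require Import all_boot all_order all_algebra.
From mathcomp Require Import all_classical all_reals all_analysis.

Set Implicit Arguments.
Unset Strict Implicit.
Unset Printing Implicit Defensive.

Import Order.TTheory GRing.Theory Num.Theory.
Import numFieldNormedType.Exports.

Local Open Scope classical_set_scope.
Local Open Scope ring_scope.

(* A non-empty set together with a field of subsets is an algebraOfSetsType
   (which is in particular pointed): F is the class of measurable sets. *)

Definition gamble (R : realType) (X : Type) (f : X -> R) : Prop :=
  bounded_fun f.

(* A lower prevision on K is a function P on all of X -> R of which only the
   values on K matter. *)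
Definition avoids_sure_loss (R : realType) (X : Type) (K : set (X -> R))
    (P : (X -> R) -> R) : Prop :=
  ~ exists (n : nat) (f : 'I_n -> X -> R), (forall i, K (f i)) /\
      sup (range (fun x => \sum_(i < n) f i x)) < \sum_(i < n) P (f i).

Section measurable_gambles.
Context (R : realType) (d : measure_display) (X : algebraOfSetsType d).

Definition simple_gamble (f : X -> R) : Prop :=
  exists (n : nat) (a : 'I_n -> R) (A : 'I_n -> set X),
    (forall i, measurable (A i)) /\
    f = (fun x => \sum_(i < n) a i * \1_(A i) x).

Definition measurable_gamble (f : X -> R) : Prop :=
  exists s : nat -> X -> R,
    (forall n, simple_gamble (s n)) /\ {uniform, s @ \oo --> f}.

Definition fa_probability (mu : {content set X -> \bar R}) : Prop :=
  mu setT = 1%E.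

(* I, restricted to the measurable gambles, is linear, continuous for the
   supremum norm, and extends the obvious integral on simple gambles. Nothing
   is required of the values of I elsewhere. *)
Definition is_dunford_integral (mu : {content set X -> \bar R})
    (I : (X -> R) -> R) : Prop :=
  [/\ forall (a b : R) (f g : X -> R),
        measurable_gamble f -> measurable_gamble g ->
        I (fun x => a * f x + b * g x) = a * I f + b * I g,
      {within [set f : {uniform X -> R} | measurable_gamble f],
        continuous (I : {uniform X -> R} -> R)} &
      forall (n : nat) (a : 'I_n -> R) (A : 'I_n -> set X),
        (forall i, measurable (A i)) ->
        I (fun x => \sum_(i < n) a i * \1_(A i) x) =
          \sum_(i < n) a i * fine (mu (A i))].

(* For a finitely additive probability mu such a functional exists, and it is
   unique on measurable gambles, the only place where it is used. *)
Definition dunford (mu : {content set X -> \bar R}) : (X -> R) -> R :=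
  xget (fun=> 0) [set I | is_dunford_integral mu I].

Definition credal (K : set (X -> R)) (P : (X -> R) -> R) :
    set {content set X -> \bar R} :=
  [set mu | fa_probability mu /\ forall f, K f -> P f <= dunford mu f].

(* When P avoids sure loss, the infimum is attained, i.e. it is a minimum. *)
Definition lower_ext (K : set (X -> R)) (P : (X -> R) -> R) (g : X -> R) : R :=
  inf [set dunford mu g | mu in credal K P].

Definition upper_ext (K : set (X -> R)) (P : (X -> R) -> R) (g : X -> R) : R :=
  - lower_ext K P (fun x => - g x).

End measurable_gambles.

Definition argmax_in (R : realType) (T : Type) (A : set T) (v : T -> R) :
    set T :=
  [set a | A a /\ forall b, A b -> v b <= v a].

Section decisions.
Context (R : realType) (d : measure_display) (X : algebraOfSetsType d).
Context (T : Type) (J : T -> X -> R).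

Definition opt_admissible (D : set T) : set T :=
  [set a | D a /\
    forall b, D b -> ~ (forall x, J a x <= J b x) \/ J b = J a].

Definition opt_expectation (mu : {content set X -> \bar R}) (D : set T) :
    set T :=
  argmax_in (opt_admissible D) (fun a => dunford mu (J a)).

Variables (K : set (X -> R)) (P : (X -> R) -> R).

Definition opt_maximin (D : set T) : set T :=
  argmax_in (opt_admissible D) (fun a => lower_ext K P (J a)).

Definition opt_maximax (D : set T) : set T :=
  argmax_in (opt_admissible D) (fun a => upper_ext K P (J a)).

Definition opt_maximal (D : set T) : set T :=
  [set a | opt_admissible D a /\
    forall b, opt_admissible D b ->
      lower_ext K P (fun x => J b x - J a x) <= 0].

Definition opt_interval (D : set T) : set T :=
  [set a | opt_admissible D a /\
    forall b, opt_admissible D b ->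
      lower_ext K P (J b) <= upper_ext K P (J a)].

Definition opt_credal (D : set T) : set T :=
  \bigcup_(mu in credal K P) opt_expectation mu D.

End decisions.

(* Main.v *)
(* By the Hahn-Banach theorem the lower natural extension is attained: for every
   measurable gamble g, some linear functional on all gambles dominates the
   lower natural extension and agrees with it at g. Its values on indicators
   form a finitely additive probability in the credal set whose Dunford integral
   is that functional. So lower_ext is a minimum and upper_ext a maximum over
   the credal set, and each inclusion compares expectations under a mu attaining
   one of them. The same extension theorem, applied to the gambles
   +-(1_A - mu A), provides the Dunford integral of an arbitrary finitely
   additive mu. *)
Require Import Defs.
From HB Require Import structures.
From mathcomp Require Import all_boot all_order all_algebra.
From mathcomp Require Import all_classical all_reals all_analysis.
From mathcomp Require Import ring lra.
Import Order.TTheory GRing.Theory Num.Theory.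
Import numFieldNormedType.Exports.
Local Open Scope classical_set_scope.
Local Open Scope ring_scope.

Set Implicit Arguments.
Unset Strict Implicit.
Unset Printing Implicit Defensive.

(** * The Hahn-Banach theorem through minimal sublinear functionals *)

Section hahn_banach.
Context (R : realType) (V : lmodType R).
Implicit Types (p q : V -> R) (x y v : V).

(** Homogeneity is asked only as an inequality, the half that survives passage to infima; equality
    follows on applying it to the inverse scalar. *)
Definition sublinear p : Prop :=
  (forall x y, p (x + y) <= p x + p y) /\
  (forall a x, 0 <= a -> p (a *: x) <= a * p x).

Lemma sublinear0 p : sublinear p -> p 0 = 0.
Proof.
move=> [pD pZ]; apply/le_anti/andP; split.
  by have := pZ 0 0 (lexx _); rewrite scale0r mul0r.
by have := pD 0 0; rewrite addr0; lra.
Qed.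

Lemma sublinearZ p a x : sublinear p -> 0 <= a -> p (a *: x) = a * p x.
Proof.
move=> ps; rewrite le_eqVlt => /orP[/eqP <-|a0].
  by rewrite scale0r mul0r (sublinear0 ps).
apply/le_anti/andP; split; first by apply: ps.2; exact: ltW.
rewrite -ler_pdivlMl//; have := ps.2 a^-1 (a *: x).
by rewrite scalerA mulVf ?gt_eqF// scale1r invr_ge0 => /(_ (ltW a0)).
Qed.

Lemma sublinear_geN p x : sublinear p -> - p (- x) <= p x.
Proof.
by move=> ps; have := ps.1 x (- x); rewrite subrr (sublinear0 ps); lra.
Qed.

(* Moving along the ray of v lowers p to a sublinear functional whose value at
   - v is - p v, as linearity demands. *)
Definition ray_inf p v x : R :=
  inf [set p (x + t *: v) - t * p v | t in [set t | 0 <= t]].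

Section ray_inf.
Variables (p : V -> R) (v : V).
Hypothesis ps : sublinear p.

Lemma ray_inf_le x t : 0 <= t -> ray_inf p v x <= p (x + t *: v) - t * p v.
Proof.
move=> t0; apply: ge_inf; last by exists t.
exists (- p (- x)) => _ [s s0 <-].
have := ps.1 (x + s *: v) (- x).
by rewrite addrAC subrr add0r sublinearZ//; lra.
Qed.

Lemma ray_inf_ge x r :
  (forall t, 0 <= t -> r <= p (x + t *: v) - t * p v) -> r <= ray_inf p v x.
Proof.
move=> H; apply: lb_le_inf; first by exists (p (x + 0 *: v) - 0 * p v), 0 => /=.
by move=> _ [t t0 <-]; exact: H.
Qed.

(** Parameters t and s for x and y combine into t + s for x + y, and multiplication by a > 0 only
    reparametrises the ray. *)
Lemma ray_inf_sublinear : sublinear (ray_inf p v).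
Proof.
split=> [x y|a x].
- rewrite -lerBlDr; apply: ray_inf_ge => t t0.
  rewrite lerBlDl -lerBlDr; apply: ray_inf_ge => s s0.
  have := ray_inf_le (x + y) (addr_ge0 t0 s0).
  have := ps.1 (x + t *: v) (y + s *: v).
  by rewrite addrACA -scalerDl; lra.
- rewrite le_eqVlt => /orP[/eqP <-|a0].
    rewrite mul0r scale0r; have := ray_inf_le 0 (lexx 0).
    by rewrite scale0r addr0 (sublinear0 ps) mul0r subr0.
  rewrite -ler_pdivrMl//; apply: ray_inf_ge => t t0.
  have := ray_inf_le (a *: x) (mulr_ge0 (ltW a0) t0).
  rewrite ler_pdivrMl// mulrBr -(sublinearZ _ ps (ltW a0)) scalerDr scalerA.
  by rewrite mulrA.
Qed.

Lemma ray_inf_dominated x : ray_inf p v x <= p x.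
Proof.
by have := ray_inf_le x (lexx 0); rewrite scale0r addr0 mul0r subr0.
Qed.

Lemma ray_infN : ray_inf p v (- v) <= - p v.
Proof.
have := ray_inf_le (- v) ler01.
by rewrite scale1r addNr (sublinear0 ps) mul1r sub0r.
Qed.

End ray_inf.

(** Zorn's lemma on the sublinear functionals below p, ordered downwards: a non-empty chain is
    bounded by its pointwise infimum. *)
Lemma minimal_sublinear p : sublinear p ->
  exists q, [/\ sublinear q, forall x, q x <= p x &
    forall r, sublinear r -> (forall x, r x <= q x) -> forall x, q x <= r x].
Proof.
move=> ps.
pose T := {q : V -> R | sublinear q /\ forall x, q x <= p x}.
pose ge_fun (s t : T) := `[< forall x, sval t x <= sval s x >].
(* This bound is the same for all s, so the pointwise infimum of a chain is finite. *)
have geN (s : T) x : - p (- x) <= sval s x.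
  case: s => q [qs qp] /=; apply: le_trans (sublinear_geN x qs).
  by rewrite lerN2.
pose t0 : T := exist _ p (conj ps (fun=> lexx _)).
have [||A totA|[q [qs qp]] qmin] := ZL_preorder t0 (R := ge_fun).
- by move=> t; apply/asboolP.
- move=> r s t /asboolP rs /asboolP st; apply/asboolP => x.
  exact: le_trans (st x) (rs x).
- have [->|/set0P[s0 As0]] := eqVneq A set0; first by exists t0.
  pose m x := inf [set sval s x | s in A].
  have mle s x : A s -> m x <= sval s x.
    move=> As; apply: ge_inf; last by exists s.
    by exists (- p (- x)) => _ [t _ <-]; exact: geN.
  have mge r x : (forall s, A s -> r <= sval s x) -> r <= m x.
    move=> H; apply: lb_le_inf; first by exists (sval s0 x), s0.
    by move=> _ [s As <-]; exact: H.
  have ms : sublinear m.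
    split=> [x y|a x].
    - rewrite -lerBlDr; apply: (mge) => s As.
      rewrite lerBlDl -lerBlDr; apply: (mge) => t At; rewrite lerBlDl.
      (* The smaller of s and t is a single member of the chain whose subadditivity bounds m at x +
         y; a family that is not a chain would offer no such member. *)
      have [/asboolP st|/asboolP ts] := totA _ _ As At.
      + apply: le_trans (mle _ _ At) _; apply: le_trans ((svalP t).1.1 _ _) _.
        by rewrite lerD2r.
      + apply: le_trans (mle _ _ As) _; apply: le_trans ((svalP s).1.1 _ _) _.
        by rewrite lerD2l.
    - rewrite le_eqVlt => /orP[/eqP <-|a0].
        rewrite mul0r scale0r; apply: le_trans (mle _ _ As0) _.
        by rewrite (sublinear0 (svalP s0).1).
      rewrite -ler_pdivrMl//; apply: (mge) => s As; rewrite ler_pdivrMl//.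
      apply: le_trans (mle _ _ As) _; apply: (svalP s).1.2; exact: ltW.
  have mp x : m x <= p x by apply: le_trans (mle _ _ As0) _; exact: (svalP s0).2.
  exists (exist _ m (conj ms mp)) => s As; apply/asboolP => x /=; exact: mle.
- exists q; split => // r rs rq.
  have rp x : r x <= p x by exact: le_trans (rq x) (qp x).
  have := qmin (exist _ r (conj rs rp)); rewrite /ge_fun/=.
  by move=> /(_ (asboolT rq))/asboolP.
Qed.

(** Minimality compared with [ray_inf q x] gives q (- x) <= - q x, so q is odd, and an odd sublinear
    functional is linear. *)
Lemma minimal_sublinear_linear q : sublinear q ->
    (forall r, sublinear r -> (forall x, r x <= q x) -> forall x, q x <= r x) ->
  linear (q : V -> R^o).
Proof.
move=> qs qmin.
have qN x : q (- x) = - q x.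
  apply/le_anti/andP; split.
    apply: le_trans (ray_infN x qs); apply: qmin.
      exact: ray_inf_sublinear.
    exact: ray_inf_dominated.
  by rewrite lerNl; exact: sublinear_geN.
have qD x y : q (x + y) = q x + q y.
  apply/le_anti/andP; split; first exact: qs.1.
  by have := qs.1 (x + y) (- y); rewrite addrK qN; lra.
move=> a x y; rewrite qD; congr (_ + _).
have [a0|/ltW a0] := leP 0 a; first exact: sublinearZ.
by rewrite -[a *: x]opprK -scaleNr qN sublinearZ ?oppr_ge0// mulNr opprK.
Qed.

(** The minimal functional is taken below [ray_inf p v] instead of p: its value at - v is then at
    most - p v, which forces equality at v. *)
Theorem hahn_banach p v : sublinear p ->
  exists L : V -> R, [/\ linear (L : V -> R^o), forall x, L x <= p x & L v = p v].
Proof.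
move=> ps; have [q [qs qp qmin]] := minimal_sublinear (ray_inf_sublinear v ps).
exists q; have qp' x := le_trans (qp x) (ray_inf_dominated v ps x).
split=> //; first exact: minimal_sublinear_linear.
apply/le_anti/andP; split=> //.
apply: le_trans (sublinear_geN _ qs); rewrite lerNr.
exact: le_trans (qp _) (ray_infN v ps).
Qed.

End hahn_banach.

(** * The vector space of gambles *)

Section gambles.
Context (R : realType) (X : Type).
Implicit Types (f g h : X -> R).

Lemma gambleP f : gamble f <-> exists M, forall x, `|f x| <= M.
Proof.
split=> [/pinfty_ex_gt0[M _ fM]|[M fM]]; first by exists M => x; exact: fM.
exists M; split=> [|N MN x _]; first exact: num_real.
exact: le_trans (fM x) (ltW MN).
Qed.

Lemma gamble_cst (c : R) : gamble ((fun=> c) : X -> R).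
Proof. by apply/gambleP; exists `|c|. Qed.

Lemma gamble_indic (A : set X) :
  gamble (\1_A : X -> R).
Proof.
apply/gambleP; exists 1 => x; rewrite indicE.
by case: (x \in A); rewrite ?normr1// normr0.
Qed.

Lemma gamble_lin (a b : R) f g : gamble f -> gamble g ->
  gamble (fun x => a * f x + b * g x).
Proof.
move=> /gambleP[M fM] /gambleP[N gN]; apply/gambleP.
exists (`|a| * M + `|b| * N) => x; apply: le_trans (ler_normD _ _) _.
by rewrite !normrM lerD// ler_wpM2l.
Qed.

Lemma gambleB f g : gamble f -> gamble g -> gamble (fun x => f x - g x).
Proof.
move=> gf gg; have := gamble_lin 1 (-1) gf gg.
by under eq_fun do rewrite mul1r mulN1r.
Qed.

Definition is_gamble : {pred X -> R} := [pred f | `[< gamble f >]].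

Lemma is_gamble_submod : submod_closed is_gamble.
Proof.
split; first by apply/asboolP/gambleP; exists 0 => x; rewrite normr0.
move=> a f g /asboolP fg /asboolP gg; apply/asboolP.
have -> : a *: f + g = (fun x => a * f x + 1 * g x).
  by apply/funext => x; rewrite fctE/= mul1r.
exact: gamble_lin.
Qed.

HB.instance Definition _ :=
  GRing.isSubmodClosed.Build R (X -> R) is_gamble is_gamble_submod.

Record gamble_type := GambleType {
  gamble_val :> X -> R; gamble_valP : gamble_val \in is_gamble }.
HB.instance Definition _ := [isSub for gamble_val].
HB.instance Definition _ := [Choice of gamble_type by <:].
HB.instance Definition _ := [SubChoice_isSubLmodule of gamble_type by <:].


(** * Cones of acceptable gambles and the expectations nonnegative on them *)

Inductive cone (G : set (X -> R)) : set (X -> R) :=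
| cone0 : cone G (fun=> 0)
| coneD (c : R) f h : 0 <= c -> G f -> cone G h ->
    cone G (fun x => c * f x + h x).

Lemma cone_add G f g : cone G f -> cone G g -> cone G (fun x => f x + g x).
Proof.
move=> Gf Gg; elim: Gf => [|c k h c0 Gk _ IH].
  by under eq_fun do rewrite add0r.
by under eq_fun do rewrite -addrA; exact: coneD.
Qed.

Lemma cone_scale G (a : R) f : 0 <= a -> cone G f -> cone G (fun x => a * f x).
Proof.
move=> a0; elim=> [|c k h c0 Gk _ IH].
  by under eq_fun do rewrite mulr0; exact: cone0.
under eq_fun do rewrite mulrDr mulrA.
by apply: coneD => //; exact: mulr_ge0.
Qed.

Lemma cone_base G f : G f -> cone G f.
Proof.
move=> Gf; have := coneD ler01 Gf (cone0 G).
by under eq_fun do rewrite mul1r addr0.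
Qed.

Lemma cone_gamble G f : G `<=` @gamble R X -> cone G f -> gamble f.
Proof.
move=> GG; elim=> [|c k h c0 Gk _ IH]; first exact: gamble_cst.
under eq_fun do rewrite -[X in _ + X]mul1r.
by apply: gamble_lin => //; exact: GG.
Qed.

(** Avoiding sure loss for G read as a set of acceptable gambles: no combination loses a fixed
    positive amount everywhere. *)
Definition coherent (G : set (X -> R)) : Prop :=
  forall h r, cone G h -> (forall x, h x <= r) -> 0 <= r.

(** The second clause encodes positivity and normalisation together, as it can be applied to a
    gamble and to its negative. *)
Definition expectation (L : (X -> R) -> R) : Prop :=
  (forall a b f g, gamble f -> gamble g ->
     L (fun x => a * f x + b * g x) = a * L f + b * L g) /\
  (forall f c, gamble f -> (forall x, f x <= c) -> L f <= c).

(* The value at g is least possible: it is the natural extension of G to g. *)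
Theorem coherent_expectation G g :
  G `<=` @gamble R X -> coherent G -> gamble g ->
  exists L, [/\ expectation L, forall f, G f -> 0 <= L f &
    forall s, (forall r h, cone G h -> (forall x, r + h x <= g x) -> r <= s) ->
      L g <= s].
Proof.
move=> GG Gcoh gg.
(* The infimum p of these bounds is the upper natural extension of G; it is sublinear, as
   Hahn-Banach requires. *)
pose dominating (f : X -> R) : set R :=
  [set r | exists2 h, cone G h & forall x, f x + h x <= r].
pose p (f : gamble_type) := inf (dominating f).
have gval (f : gamble_type) : gamble f by apply/asboolP; exact: gamble_valP.
have ple (f : gamble_type) h r :
    cone G h -> (forall x, f x + h x <= r) -> p f <= r.
  move=> Gh fhr; apply: ge_inf; last by exists h.
  have /gambleP[M fM] := gval f.
  (* From f >= - M follows k <= s + M, and coherence gives s + M >= 0. *)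
  exists (- M) => s [k Gk fks]; rewrite -subr_ge0 opprK; apply: (Gcoh _ _ Gk) => x.
  by have := fks x; have := fM x; rewrite ler_norml => /andP[]; lra.
have pge (f : gamble_type) s :
    (forall h r, cone G h -> (forall x, f x + h x <= r) -> s <= r) -> s <= p f.
  move=> H; apply: lb_le_inf; last by move=> r [h Gh fhr]; exact: H fhr.
  have /gambleP[M fM] := gval f.
  exists M, (fun=> 0); first exact: cone0.
  by move=> x; rewrite addr0; exact: le_trans (ler_norm _) (fM x).
have ps : sublinear p.
  split=> [f1 f2|a f].
  - rewrite -lerBlDr; apply: (pge) => h1 r1 Gh1 H1.
    rewrite lerBlDl -lerBlDr; apply: (pge) => h2 r2 Gh2 H2; rewrite lerBlDl.
    apply: (ple _ _ _ (cone_add Gh1 Gh2)) => x.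
    rewrite /= addrACA; apply: lerD; [exact: H1|exact: H2].
  - rewrite le_eqVlt => /orP[/eqP <-|a0].
      rewrite mul0r scale0r; apply: (ple _ _ _ (cone0 G)) => x.
      by rewrite addr0.
    rewrite -ler_pdivrMl//; apply: (pge) => h r Gh H; rewrite ler_pdivrMl//.
    apply: (ple _ _ _ (cone_scale (ltW a0) Gh)) => x.
    by rewrite /= -mulrDr ler_pM2l.
have gP f : gamble f -> f \in is_gamble by move=> ?; apply/asboolP.
(* Contact with p at - g makes L g equal to - p (- g), the lower natural extension at g. *)
have [L [Llin Lp Lg]] := hahn_banach (- GambleType (gP _ gg)) ps.
(* Unbounded functions are sent to 0; [expectation] constrains L on gambles only. *)
pose tog f : gamble_type := insubd 0 f.
have togE f : gamble f -> gamble_val (tog f) = f.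
  by move=> gf; rewrite /tog insubdK//; exact: (gP).
have LD c (f1 f2 : gamble_type) : L (c *: f1 + f2) = c * L f1 + L f2.
  exact: Llin.
have L0 : L 0 = 0 by have := LD 1 0 0; rewrite scale1r addr0; lra.
have LN (f : gamble_type) : L (- f) = - L f.
  by have := LD (-1) f 0; rewrite scaleN1r addr0 L0 mulN1r addr0.
exists (L \o tog); split=> /=.
- split=> [a b f1 f2 g1 g2|f c gf fc] /=.
    have -> : tog (fun x => a * f1 x + b * f2 x) = a *: tog f1 + b *: tog f2.
      apply/val_inj; rewrite /= togE; last exact: gamble_lin.
      by rewrite /= !togE.
    by rewrite LD -[b *: _]addr0 LD L0 addr0.
  apply: le_trans (Lp _) _; apply: (ple _ _ _ (cone0 G)) => x.
  by rewrite addr0 togE.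
- move=> f Gf; rewrite -oppr_le0 -LN; apply: le_trans (Lp _) _.
  apply: (ple _ _ _ (cone_base Gf)) => x /=.
  by rewrite togE ?addNr//; exact: GG.
- move=> s H.
  have -> : tog g = GambleType (gP _ gg) by apply: val_inj; exact: togE.
  rewrite -lerN2 -LN Lg; apply: pge => h r Gh gr; rewrite lerNl.
  apply: (H _ _ Gh) => x; have := gr x; rewrite /=.
  by rewrite -[(- g) x]/(- g x); lra.
Qed.

End gambles.

(** * Monotonicity, continuity and finite sums for expectations *)

Section expectation_theory.
Context (R : realType) (X : Type) (L : (X -> R) -> R).
Hypothesis eL : expectation L.
Implicit Types (f g : X -> R).

Lemma expectationB f g : gamble f -> gamble g ->
  L (fun x => f x - g x) = L f - L g.
Proof.
move=> gf gg; have := eL.1 1 (-1) _ _ gf gg.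
by under eq_fun do rewrite mul1r mulN1r; rewrite mul1r mulN1r.
Qed.

Lemma expectation_le f g : gamble f -> gamble g ->
  (forall x, f x <= g x) -> L f <= L g.
Proof.
move=> gf gg fg; rewrite -subr_le0 -expectationB//; apply: eL.2 => [|x].
  exact: gambleB.
by rewrite subr_le0.
Qed.

Lemma expectation_contraction f g (e : R) : gamble f -> gamble g ->
  (forall x, `|f x - g x| <= e) -> `|L f - L g| <= e.
Proof.
move=> gf gg fge; rewrite ler_norml -lerNl opprB -!expectationB//.
by apply/andP; split; apply: eL.2 => [|x]; try exact: gambleB;
  apply: le_trans (fge x); rewrite ?ler_norm// distrC ler_norm.
Qed.

Lemma expectation_cst c : L (fun=> c) = c.
Proof.
apply/le_anti/andP; split; first by apply: eL.2 => //; exact: gamble_cst.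
have /(_ (gamble_cst _ _)) := eL.2 (fun=> - c) (- c).
have := eL.1 (-1) 0 _ _ (gamble_cst X c) (gamble_cst X c).
under eq_fun do rewrite mulN1r mul0r addr0.
by rewrite mulN1r mul0r addr0 => -> /(_ (fun=> lexx _)); rewrite lerN2.
Qed.

Lemma expectation_sum n (a : 'I_n -> R) (f : 'I_n -> X -> R) :
  (forall i, gamble (f i)) ->
  gamble (fun x => \sum_(i < n) a i * f i x) /\
  L (fun x => \sum_(i < n) a i * f i x) = \sum_(i < n) a i * L (f i).
Proof.
elim: n a f => [|n IH] a f gf.
  rewrite big_ord0; under eq_fun do rewrite big_ord0.
  by split; [exact: gamble_cst|exact: expectation_cst].
rewrite big_ord_recr /=; under eq_fun do rewrite big_ord_recr /= -[X in X + _]mul1r.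
pose w i := widen_ord (leqnSn n) i.
have [gs Ls] := IH (a \o w) (f \o w) (fun i => gf (w i)).
split; first exact: gamble_lin.
by rewrite eL.1// mul1r Ls.
Qed.

End expectation_theory.

(** * Uniform convergence in epsilon form, and closure properties of measurable gambles *)

Lemma nbhs_uniformP (R : realType) (X : choiceType) (f : {uniform X -> R})
    (P : set {uniform X -> R}) :
  nbhs f P <->
  exists2 e : R, 0 < e & forall h : X -> R, (forall x, `|f x - h x| < e) -> P h.
Proof.
rewrite uniform_nbhs; split=> [[E [+ EP]]|[e e0 eP]].
  rewrite -entourage_ballE => -[e /= e0 eE]; exists e => // h fh.
  by apply: EP => x _; apply: eE; exact: fh.
exists [set xy | `|xy.1 - xy.2| < e]; split.
  by rewrite -entourage_ballE; exists e.
by move=> h fh; apply: eP => x; exact: fh.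
Qed.

Lemma cvg_uniformP (R : realType) (X : choiceType) (s : nat -> X -> R)
    (f : X -> R) :
  {uniform, s @ \oo --> f} <->
  forall e : R, 0 < e -> \forall n \near \oo, forall x, `|f x - s n x| < e.
Proof.
split=> [sf e e0|sf P /nbhs_uniformP[e e0 eP]].
  apply: (sf [set g : X -> R | forall x, `|f x - g x| < e]).
  by apply/nbhs_uniformP; exists e.
by apply: filterS (sf _ e0) => n; exact: eP.
Qed.

Section measurable_gambles.
Context (R : realType) (d : measure_display) (X : algebraOfSetsType d).
Implicit Types (f g : X -> R) (A B : set X).

Lemma simple_gamble_gamble f : simple_gamble f -> gamble f.
Proof.
move=> [n [a [A [_ ->]]]]; elim: n a A => [|n IH] a A.
  by under eq_fun do rewrite big_ord0; exact: gamble_cst.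
under eq_fun do rewrite big_ord_recr /= -[X in X + _]mul1r.
by apply: gamble_lin; [exact: IH|exact: gamble_indic].
Qed.

Lemma simple_gamble_lin (a b : R) f g : simple_gamble f -> simple_gamble g ->
  simple_gamble (fun x => a * f x + b * g x).
Proof.
move=> [n [u [A [mA ->]]]] [m [v [B [mB ->]]]].
exists (n + m)%N.
exists (fun i =>
  match fintype.split i with inl j => a * u j | inr k => b * v k end).
exists (fun i => match fintype.split i with inl j => A j | inr k => B k end).
split=> [i|]; first by case: (fintype.split i).
apply/funext => x; rewrite big_split_ord /= !big_distrr /=.
congr (_ + _); apply: eq_bigr => i _; rewrite mulrA.
  by rewrite (unsplitK (inl i)).
by rewrite (unsplitK (inr i)).
Qed.

Lemma simple_measurable_gamble f : simple_gamble f -> measurable_gamble f.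
Proof.
move=> sf; exists (fun=> f); split=> //; apply/cvg_uniformP => e e0.
by apply: nearW => n x; rewrite subrr normr0.
Qed.

Lemma measurable_gamble_gamble f : measurable_gamble f -> gamble f.
Proof.
move=> [s [ss /cvg_uniformP/(_ 1 ltr01)[N _ /(_ N (leqnn N)) fs]]].
have /gambleP[M sM] := simple_gamble_gamble (ss N).
apply/gambleP; exists (1 + M) => x; rewrite -[f x](subrK (s N x)).
by apply: le_trans (ler_normD _ _) _; apply: lerD => //; apply/ltW/fs.
Qed.

Lemma measurable_gamble_lin (a b : R) f g :
  measurable_gamble f -> measurable_gamble g ->
  measurable_gamble (fun x => a * f x + b * g x).
Proof.
move=> [s [ss /cvg_uniformP sf]] [t [st /cvg_uniformP tg]].
exists (fun n x => a * s n x + b * t n x); split=> [n|].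
  exact: simple_gamble_lin.
apply/cvg_uniformP => e e0.
(* The summand 1 keeps c positive when a and b vanish and leaves a surplus e / c that makes the
   final bound strict. *)
pose c : R := `|a| + `|b| + 1.
have c0 : 0 < c by rewrite ltr_wpDl// addr_ge0.
near=> n => x.
have sn : `|f x - s n x| < e / c.
  by move: x; near: n; apply: sf; rewrite divr_gt0.
have tn : `|g x - t n x| < e / c.
  by move: x {sn}; near: n; apply: tg; rewrite divr_gt0.
rewrite [X in `|X|](_ : _ = a * (f x - s n x) + b * (g x - t n x)); last by ring.
apply: le_lt_trans (ler_normD _ _) _; rewrite !normrM.
have -> : e = `|a| * (e / c) + `|b| * (e / c) + e / c.
  by rewrite -!mulrDl -{2}[e / c]mul1r -mulrDl mulrCA mulfV ?gt_eqF// mulr1.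
rewrite ltr_pwDr ?divr_gt0//.
by apply: lerD; apply: ler_wpM2l => //; exact: ltW.
Unshelve. all: by end_near. Qed.

Lemma measurable_gambleB f g : measurable_gamble f -> measurable_gamble g ->
  measurable_gamble (fun x => f x - g x).
Proof.
move=> mf mg; have := measurable_gamble_lin 1 (-1) mf mg.
by under eq_fun do rewrite mul1r mulN1r.
Qed.

Lemma measurable_gambleN f : measurable_gamble f ->
  measurable_gamble (fun x => - f x).
Proof.
move=> mf; have := measurable_gamble_lin (-1) 0 mf mf.
by under eq_fun do rewrite mulN1r mul0r addr0.
Qed.

End measurable_gambles.

(** * Uniqueness of the Dunford integral and its identification with expectations *)

Section dunford_integral.
Context (R : realType) (d : measure_display) (X : algebraOfSetsType d).
Variable mu : {content set X -> \bar R}.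
Implicit Types (f g : X -> R) (A B : set X).

(** Both functionals agree on simple gambles, which are uniformly dense among the measurable ones,
    and both are continuous there. *)
Lemma dunford_integral_unique (I1 I2 : (X -> R) -> R) f :
  is_dunford_integral mu I1 -> is_dunford_integral mu I2 ->
  measurable_gamble f -> I1 f = I2 f.
Proof.
move=> dI1 dI2 mf; have [s [ss sf]] := mf.
have Is I : is_dunford_integral mu I -> I (s n) @[n --> \oo] --> I f.
  move=> [_ /subspace_continuousP/(_ f mf) If _].
  apply: cvg_trans If => P nP.
  have sP : \forall n \near \oo, measurable_gamble (s n) -> P (I (s n)).
    exact: (sf [set g | measurable_gamble g -> P (I g)] nP).
  apply: (filterS _ sP) => n; apply; exact: simple_measurable_gamble.
apply: (cvg_unique _ (Is _ dI1)) => //.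
suff -> : (fun n => I1 (s n)) = (fun n => I2 (s n)) by exact: Is.
apply/funext => n; have [m [a [A [mA ->]]]] := ss n.
by case: dI1 => _ _ ->//; case: dI2 => _ _ ->.
Qed.

(** Continuity holds because an expectation is 1-Lipschitz for the supremum norm. *)
Lemma expectation_dunford_integral (L : (X -> R) -> R) : expectation L ->
    (forall A, measurable A -> L \1_A = fine (mu A)) ->
  is_dunford_integral mu L.
Proof.
move=> eL Lmu; split=> [a b f g mf mg||n a A mA].
- by apply: eL.1; exact: measurable_gamble_gamble.
- apply/subspace_continuousP => f mf; apply/cvgrPdist_le => e e0.
  apply/nbhs_uniformP; exists e => // g fg mg.
  by apply: (expectation_contraction eL) => // [||x];
    [exact: measurable_gamble_gamble..|exact/ltW].
- have [|_ ->] := expectation_sum eL a (f := fun i => \1_(A i)).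
    by move=> i; exact: gamble_indic.
  by apply: eq_bigr => i _; rewrite Lmu.
Qed.

(** L witnesses that the set from which [dunford] chooses is non-empty, so the choice is a Dunford
    integral and uniqueness applies. *)
Lemma dunford_expectation (L : (X -> R) -> R) : expectation L ->
    (forall A, measurable A -> L \1_A = fine (mu A)) ->
  forall f, measurable_gamble f -> dunford mu f = L f.
Proof.
move=> eL Lmu f mf; have dL := expectation_dunford_integral eL Lmu.
apply: dunford_integral_unique mf => //.
exact: (xgetI _ dL).
Qed.

End dunford_integral.

(** * Existence of the Dunford integral of a finitely additive probability *)

Section fa_probability_theory.
Context (R : realType) (d : measure_display) (X : algebraOfSetsType d).
Variable mu : {content set X -> \bar R}.
Hypothesis mu1 : fa_probability mu.
Implicit Types (A B : set X).

Lemma fa_probability_fin A : measurable A -> mu A \is a fin_num.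
Proof.
move=> mA; rewrite ge0_fin_numE ?measure_ge0//.
apply: (@le_lt_trans _ _ (mu setT)); last by rewrite (mu1 : mu setT = 1%E) ltry.
by apply: le_measure => //; rewrite inE//; exact: measurableT.
Qed.

Lemma fine_contentDI A B : measurable A -> measurable B ->
  fine (mu A) = fine (mu (A `&` B)) + fine (mu (A `\` B)).
Proof.
move=> mA mB; rewrite (measureDI mu mA mB) fineD ?fa_probability_fin//.
- by rewrite addrC.
- exact: measurableD.
- exact: measurableI.
Qed.

(* Carrying the constant c and the set B lets the induction split B along each
   set of s, so that only two-set additivity is needed. *)
Lemma simple_integral_ge0 (s : seq (R * set X)) (c : R) B :
  measurable B -> (forall p, p \in s -> measurable p.2) ->
  (forall x, B x -> 0 <= c + \sum_(p <- s) p.1 * \1_(p.2) x) ->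
  0 <= c * fine (mu B) + \sum_(p <- s) p.1 * fine (mu (p.2 `&` B)).
Proof.
elim: s c B => [|[a A] s IH] c B mB ms H.
  rewrite big_nil addr0.
  have [->|/set0P[x Bx]] := eqVneq B set0; first by rewrite measure0 mulr0.
  rewrite mulr_ge0 ?fine_ge0 ?measure_ge0//.
  by have := H x Bx; rewrite big_nil addr0.
have mA : measurable A by exact: (ms (a, A) (mem_head _ _)).
have ms' p : p \in s -> measurable p.2.
  by move=> ps; apply: ms; rewrite in_cons ps orbT.
(* The indicator of A is 1 on the first piece, where a joins the constant, and 0 on the second,
   where c is unchanged. *)
have HI := IH (c + a) (B `&` A) (measurableI _ _ mB mA) ms' _.
have HD := IH c (B `\` A) (measurableD mB mA) ms' _.
rewrite big_cons /=.
have -> : \sum_(p <- s) p.1 * fine (mu (p.2 `&` B)) =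
    \sum_(p <- s) p.1 * fine (mu (p.2 `&` (B `&` A))) +
    \sum_(p <- s) p.1 * fine (mu (p.2 `&` (B `\` A))).
  rewrite -big_split /=; apply: eq_big_seq => p ps.
  rewrite (fine_contentDI _ mA); last by apply: measurableI => //; exact: ms'.
  by rewrite mulrDr setIA setIDA.
rewrite (fine_contentDI mB mA) [A `&` B]setIC.
have {}HI : 0 <= (c + a) * fine (mu (B `&` A)) +
    \sum_(p <- s) p.1 * fine (mu (p.2 `&` (B `&` A))).
  apply: HI => x [Bx Ax]; have := H x Bx.
  by rewrite big_cons /= indicE mem_set// mulr1 addrA.
have {}HD : 0 <= c * fine (mu (B `\` A)) +
    \sum_(p <- s) p.1 * fine (mu (p.2 `&` (B `\` A))).
  apply: HD => x [Bx nAx]; have := H x Bx.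
  by rewrite big_cons /= indicE memNset// mulr0 add0r.
by lra.
Qed.

(** With both signs present, an expectation nonnegative on this set must take the value mu A at the
    indicator of A. *)
Definition centered_indicators : set (X -> R) :=
  [set f | exists A, measurable A /\
    (f = (fun x => \1_A x - fine (mu A)) \/ f = (fun x => fine (mu A) - \1_A x))].

Lemma cone_centered_indicators h : cone centered_indicators h ->
  exists2 s : seq (R * set X), forall p, p \in s -> measurable p.2 &
    h = fun x => \sum_(p <- s) p.1 * \1_(p.2) x - \sum_(p <- s) p.1 * fine (mu p.2).
Proof.
elim=> [|c f g c0 [A [mA fE]] _ [s ms ->]].
  by exists [::] => //; apply/funext => x; rewrite !big_nil subr0.
have ms' a p : p \in (a, A) :: s -> measurable p.2.
  by rewrite in_cons => /orP[/eqP ->//|]; exact: ms.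
case: fE => ->; [exists ((c, A) :: s)|exists ((- c, A) :: s)]; try exact: ms';
  by apply/funext => x; rewrite !big_cons /=; ring.
Qed.

(** If h <= r, then r - h is a nonnegative simple gamble whose elementary integral is r, because mu
    has total mass 1. *)
Lemma centered_indicators_coherent : coherent centered_indicators.
Proof.
move=> h r /cone_centered_indicators[s ms ->] H.
pose t := [seq (- p.1, p.2) | p <- s].
have mt p : p \in t -> measurable p.2 by move=> /mapP[q /ms mq ->].
have tE (F : set X -> R) :
    \sum_(p <- t) p.1 * F p.2 = - \sum_(p <- s) p.1 * F p.2.
  by rewrite big_map -sumrN; apply: eq_bigr => p _; rewrite mulNr.
have := simple_integral_ge0 (c := r + \sum_(p <- s) p.1 * fine (mu p.2))
  measurableT mt.
rewrite (tE (fun A => fine (mu (A `&` setT)))).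
rewrite [X in _ - X](eq_bigr (fun p => p.1 * fine (mu p.2))); last first.
  by move=> p _; rewrite setIT.
rewrite (mu1 : mu setT = 1%E) /= mulr1 addrK; apply => x _.
by rewrite (tE (fun A => \1_A x)); have := H x; lra.
Qed.

Lemma centered_indicators_gamble : centered_indicators `<=` @gamble R X.
Proof.
move=> f [A [_ fE]].
have gA := gamble_indic R A; have gc := gamble_cst X (fine (mu A)).
by case: fE => ->; exact: gambleB.
Qed.

(** This transfers linearity and monotonicity of expectations to [dunford mu] on measurable
    gambles. *)
Lemma dunfordP : exists2 L : (X -> R) -> R, expectation L &
  forall f, measurable_gamble f -> dunford mu f = L f.
Proof.
have [L [eL LG _]] := coherent_expectation centered_indicators_gamble
  centered_indicators_coherent (gamble_cst X 0).
exists L => //; apply: dunford_expectation => // A mA.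
have gA := gamble_indic R A; have gc := gamble_cst X (fine (mu A)).
apply/le_anti/andP; split; rewrite -subr_ge0.
  rewrite -[X in X - _](expectation_cst eL) -(expectationB eL gc gA).
  by apply: LG; exists A; split=> //; right.
rewrite -[X in _ - X](expectation_cst eL) -(expectationB eL gA gc).
by apply: LG; exists A; split=> //; left.
Qed.

End fa_probability_theory.

(** * From an expectation back to a finitely additive probability *)

Section content_of_expectation.
Context (R : realType) (d : measure_display) (X : algebraOfSetsType d).
Variable L : (X -> R) -> R.
Hypothesis eL : expectation L.

(** The proof is an argument so that the content structure, which depends on it, can be attached to
    this constant. *)
Definition expectation_content of expectation L := fun A : set X => (L \1_A)%:E.

Let mu := expectation_content eL.

Let mu_ge0 A : (0 <= mu A)%E.
Proof.
rewrite lee_fin -(expectation_cst eL 0); apply: (expectation_le eL).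
- exact: gamble_cst.
- exact: gamble_indic.
- by move=> x; rewrite indicE.
Qed.

Let mu_semi_additive : measure_function.semi_additive mu.
Proof.
apply/additive2P.
  rewrite /mu /expectation_content indic0.
  by congr (_%:E); exact: expectation_cst.
move=> A B mA mB AB0; rewrite /mu /expectation_content -EFinD; congr (_%:E).
rewrite -[L \1_A]mul1r -[L \1_B]mul1r -eL.1; try exact: gamble_indic.
congr L; apply/funext => x; rewrite !mul1r !indicE in_setU.
have : (x \in A) && (x \in B) = false by rewrite -in_setI AB0 in_set0.
by case: (x \in A); case: (x \in B) => //=; rewrite ?addr0 ?add0r.
Qed.

HB.instance Definition _ :=
  isContent.Build _ _ _ (expectation_content eL) mu_ge0 mu_semi_additive.

Lemma content_of_expectation : exists2 nu : {content set X -> \bar R},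
  fa_probability nu & forall f, measurable_gamble f -> dunford nu f = L f.
Proof.
exists (expectation_content eL : {content set X -> \bar R}).
  rewrite /fa_probability /= /expectation_content indicT.
  by congr (_%:E); exact: expectation_cst.
by apply: dunford_expectation.
Qed.

End content_of_expectation.

(** * Avoiding sure loss makes the marginal gambles coherent *)

Section avoids_sure_loss.
Context (R : realType) (X : pointedType) (K : set (X -> R)) (P : (X -> R) -> R).
Hypothesis K_gamble : forall f, K f -> gamble f.
Implicit Types (f g h : X -> R).

(** The net gain from buying f at price P f; an expectation is nonnegative on all of these exactly
    when it dominates P on K. *)
Definition marginal_gambles : set (X -> R) :=
  [set (fun x => f x - P f) | f in K].

Lemma marginal_gambles_gamble : marginal_gambles `<=` @gamble R X.
Proof.
by move=> _ [f /K_gamble gf <-]; apply: gambleB => //; exact: gamble_cst.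
Qed.

Definition marginal_sum h : Prop := exists (n : nat) (f : 'I_n -> X -> R),
  (forall i, K (f i)) /\ h = fun x => \sum_(i < n) (f i x - P (f i)).

Lemma marginal_sum_add (m : nat) f h : K f -> marginal_sum h ->
  marginal_sum (fun x => m%:R * (f x - P f) + h x).
Proof.
move=> Kf sh; elim: m => [|m [n [g [Kg gE]]]].
  by under eq_fun do rewrite mul0r add0r.
exists n.+1, (fun i => if unlift ord0 i is Some j then g j else f).
split=> [i|]; first by case: unliftP.
apply/funext => x; rewrite big_ord_recl unlift_none.
under eq_bigr do rewrite liftK.
rewrite -(congr1 (@^~ x) gE) /= -natr1; ring.
Qed.

(* Avoiding sure loss only speaks of sums with natural coefficients: round the
   coefficients of N h down, at a cost which does not depend on N. *)
Lemma cone_marginal_sum h : cone marginal_gambles h ->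
  exists M, forall N : nat, exists2 k, marginal_sum k &
    forall x, `|N%:R * h x - k x| <= M.
Proof.
elim=> [|c _ h' c0 [f Kf <-] _ [M HM]].
  exists 0 => N; exists (fun=> 0).
    exists 0%N, (fun=> cst 0); split; first by case.
    by apply/funext => x; rewrite big_ord0.
  by move=> x; rewrite mulr0 subrr normr0.
have /gambleP[B fB] : gamble (fun x => f x - P f).
  by apply: marginal_gambles_gamble; exists f.
exists (B + M) => N; have [k sk Hk] := HM N.
have /andP[t1 t2] := truncn_itv (mulr_ge0 (ler0n R N) c0).
(* t is the integer part of N c; the error N c - t lies between 0 and 1, so this generator adds at
   most B to the bound. *)
set t := Num.truncn _ in t1 t2.
exists (fun x => t%:R * (f x - P f) + k x); first exact: marginal_sum_add.
move=> x; rewrite [X in `|X|](_ : _ =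
  (N%:R * c - t%:R) * (f x - P f) + (N%:R * h' x - k x)); last by ring.
apply: le_trans (ler_normD _ _) _; apply: lerD => //; rewrite normrM.
rewrite -[B]mul1r; apply: ler_pM => //.
rewrite -natr1 in t2; rewrite ger0_norm ?subr_ge0//; lra.
Qed.

Lemma marginal_gambles_coherent :
  avoids_sure_loss K P -> coherent marginal_gambles.
Proof.
move=> asl h r /cone_marginal_sum[M HM] hr; rewrite leNgt; apply/negP => r0.
(* This N makes N r + M < - 1, so the rounded sum stays below - 1 everywhere; the margin 1 keeps the
   inequality strict after taking the supremum. *)
pose N := (Num.truncn ((M + 1) / - r)).+1.
have NM : M + 1 < N%:R * - r.
  by rewrite -ltr_pdivrMr ?oppr_gt0//; exact: truncnS_gt.
have [_ [n [f [Kf ->]]] Hk] := HM N.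
apply: asl; exists n, f; split=> //.
apply: (@le_lt_trans _ _ (\sum_(i < n) P (f i) - 1)); last first.
  by rewrite ltrBlDr ltrDl.
apply: ge_sup; first by exists (\sum_(i < n) f i point), point.
move=> _ [x _ <-]; have := Hk x; rewrite sumrB ler_norml => /andP[+ _].
have : N%:R * h x <= N%:R * r by rewrite ler_wpM2l.
rewrite mulrN in NM; lra.
Qed.

End avoids_sure_loss.

(** * The natural extensions as attained extrema over the credal set *)

Section natural_extension.
Context (R : realType) (d : measure_display) (X : algebraOfSetsType d).
Context (K : set (X -> R)) (P : (X -> R) -> R).
Hypotheses (P_asl : avoids_sure_loss K P)
  (K_meas : forall f, K f -> measurable_gamble f).
Implicit Types (f g : X -> R) (mu nu : {content set X -> \bar R}).

Let K_gamble f : K f -> gamble f.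
Proof. by move=> /K_meas; exact: measurable_gamble_gamble. Qed.

(** The least expectation nonnegative on the marginal gambles yields mu. Any nu in the credal set
    has an integral E nonnegative on their cone, so r + h <= g implies r <= E g, and E g bounds the
    natural extension. *)
Lemma credal_min g : measurable_gamble g -> exists2 mu, credal K P mu &
  forall nu, credal K P nu -> dunford mu g <= dunford nu g.
Proof.
move=> mg; have gg := measurable_gamble_gamble mg.
have MG := marginal_gambles_gamble (P := P) K_gamble.
have [L [eL LP Lmin]] :=
  coherent_expectation MG (marginal_gambles_coherent K_gamble P_asl) gg.
have PL (E : (X -> R) -> R) f : expectation E -> K f ->
    E (fun x => f x - P f) = E f - P f.
  move=> eE Kf; rewrite (expectationB eE (K_gamble Kf) (gamble_cst X _)).
  by rewrite (expectation_cst eE).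
have [mu mu1 muL] := content_of_expectation eL.
exists mu.
  split=> // f Kf; rewrite muL; last exact: K_meas.
  by rewrite -subr_ge0 -(PL _ _ eL Kf); apply: LP; exists f.
move=> nu [nu1 nuP]; rewrite muL//.
have [E eE nuE] := dunfordP nu1; rewrite nuE//.
apply: Lmin => r h Gh rhg.
have E0 : 0 <= E h.
  elim: Gh => [|c _ h' c0 [f Kf <-] Gh' IH]; first by rewrite (expectation_cst eE).
  under eq_fun do rewrite -[h' _]mul1r.
  rewrite eE.1; [|by apply: MG; exists f|exact: cone_gamble Gh'].
  rewrite mul1r addr_ge0// mulr_ge0// PL// subr_ge0 -nuE; last exact: K_meas.
  exact: nuP.
have gh := cone_gamble MG Gh.
apply: (@le_trans _ _ (1 * E (fun=> r) + 1 * E h)).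
  by rewrite (expectation_cst eE) !mul1r lerDl.
rewrite -eE.1//; last exact: gamble_cst.
apply: (expectation_le eE) => //.
  by apply: gamble_lin => //; exact: gamble_cst.
by move=> x; rewrite !mul1r.
Qed.

(** A real [inf] is meaningful only on a non-empty set bounded below; the minimiser provides
    both. *)
Lemma lower_ext_min g : measurable_gamble g ->
  exists2 mu, credal K P mu & dunford mu g = lower_ext K P g.
Proof.
move=> /credal_min[mu cmu mumin]; exists mu => //.
apply/le_anti/andP; split.
  by apply: lb_le_inf; [exists (dunford mu g), mu|move=> _ [nu /mumin ? <-]].
apply: ge_inf; last by exists mu.
by exists (dunford mu g) => _ [nu /mumin ? <-].
Qed.

Lemma lower_ext_le g mu : measurable_gamble g -> credal K P mu ->
  lower_ext K P g <= dunford mu g.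
Proof.
move=> /credal_min[nu _ numin] cmu; apply: ge_inf; last by exists mu.
by exists (dunford nu g) => _ [rho /numin ? <-].
Qed.

Lemma dunfordB mu f g : credal K P mu ->
  measurable_gamble f -> measurable_gamble g ->
  dunford mu (fun x => f x - g x) = dunford mu f - dunford mu g.
Proof.
move=> [/dunfordP[E eE muE] _] mf mg.
rewrite !muE//; last exact: measurable_gambleB.
by apply: (expectationB eE); exact: measurable_gamble_gamble.
Qed.

Lemma dunfordN mu f : credal K P mu -> measurable_gamble f ->
  dunford mu (fun x => - f x) = - dunford mu f.
Proof.
move=> cmu mf.
have m0 : measurable_gamble (fun x => f x - f x) by exact: measurable_gambleB.
have := dunfordB cmu m0 mf; rewrite (dunfordB cmu mf mf) subrr sub0r => <-.
by under [in RHS]eq_fun do rewrite subrr sub0r.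
Qed.

Lemma upper_ext_max g : measurable_gamble g ->
  exists2 mu, credal K P mu & dunford mu g = upper_ext K P g.
Proof.
move=> mg; have [mu cmu muE] := lower_ext_min (measurable_gambleN mg).
by exists mu => //; rewrite /upper_ext -muE dunfordN// opprK.
Qed.

Lemma upper_ext_ge g mu : measurable_gamble g -> credal K P mu ->
  dunford mu g <= upper_ext K P g.
Proof.
move=> mg cmu; rewrite lerNr -dunfordN//; apply: lower_ext_le => //.
exact: measurable_gambleN.
Qed.

End natural_extension.

(** * The four inclusions between optimality operators *)

Theorem theorem1 (R : realType) (d : measure_display) (X : algebraOfSetsType d)
  (T : Type) (D : set T) (J : T -> X -> R)
  (K : set (X -> R)) (P : (X -> R) -> R)
  (J_gamble : forall a, D a -> gamble (J a))
  (K_gamble : forall f, K f -> gamble f)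
  (P_asl : avoids_sure_loss K P)
  (J_meas : forall a, D a -> measurable_gamble (J a))
  (K_meas : forall f, K f -> measurable_gamble f) :
  [/\ opt_maximax J K P D `<=` opt_credal J K P D,
      opt_credal J K P D `<=` opt_maximal J K P D,
      opt_maximal J K P D `<=` opt_interval J K P D &
      opt_maximin J K P D `<=` opt_maximal J K P D].
Proof.
have oJ a : opt_admissible J D a -> measurable_gamble (J a).
  by move=> [Da _]; exact: J_meas.
have oJB a b : opt_admissible J D a -> opt_admissible J D b ->
    measurable_gamble (fun x => J b x - J a x).
  by move=> /oJ ma /oJ mb; exact: measurable_gambleB.
have maximal_le mu a b : credal K P mu ->
    opt_admissible J D a -> opt_admissible J D b ->
    lower_ext K P (fun x => J b x - J a x) <= dunford mu (J b) - dunford mu (J a).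
  move=> cmu oa ob; rewrite -(dunfordB cmu (oJ _ ob) (oJ _ oa)).
  exact: (lower_ext_le P_asl K_meas (oJB _ _ oa ob) cmu).
split=> a.
(* mu attains the upper extension at [J a]; the expectation of [J b] under it is at most the upper
   extension at [J b], hence at most that at [J a]. *)
- move=> [oa amax]; have [mu cmu muE] := upper_ext_max P_asl K_meas (oJ _ oa).
  exists mu => //; split=> // b ob; rewrite muE.
  exact: le_trans (upper_ext_ge P_asl K_meas (oJ _ ob) cmu) (amax _ ob).
- move=> [mu cmu [oa amax]]; split=> // b ob.
  by apply: le_trans (maximal_le _ _ _ cmu oa ob) _; rewrite subr_le0 amax.
- move=> [oa amax]; split=> // b ob.
  (* Maximality of a means that the mu attaining the lower extension at the difference does not
     prefer b to a; the expectations under mu then separate the two bounds. *)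
  have [mu cmu muE] := lower_ext_min P_asl K_meas (oJB _ _ oa ob).
  have := amax _ ob; rewrite -muE (dunfordB cmu (oJ _ ob) (oJ _ oa)) subr_le0.
  move=> ba; apply: le_trans (lower_ext_le P_asl K_meas (oJ _ ob) cmu) _.
  exact: le_trans ba (upper_ext_ge P_asl K_meas (oJ _ oa) cmu).
- move=> [oa amax]; split=> // b ob.
  (* mu is chosen for the rival b: its expectation of [J b] is the lower extension at [J b], while
     that of [J a] is at least the lower extension at [J a]. *)
  have [mu cmu muE] := lower_ext_min P_asl K_meas (oJ _ ob).
  apply: le_trans (maximal_le _ _ _ cmu oa ob) _; rewrite muE subr_le0.
  exact: le_trans (amax _ ob) (lower_ext_le P_asl K_meas (oJ _ oa) cmu).
Qed.
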